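(* Consider $dx_t=\frac1\varepsilon[\mu(t)x_t-x_t^3]dt+\frac{\sigma}{\sqrt\varepsilon}dW_t$ with $\mu(t)=t+O(t^2)$ monotonously increasing on $[t_0,T]$, $t_0<0<T$, and let $\alpha(t,s)=\int_s^t\mu(u)du$. For $\varrho\in[0,2/3)$ define $$\mathcal D(\varrho)=\bigl\{(x,t):\sqrt\varepsilon\le t\le T,\ |x|\le\sqrt{(1-\varrho)\mu(t)}\bigr\}.$$ Assume $\sigma|\log\sigma|^{3/2}=O(\sqrt\varepsilon)$. Then for any $\varrho\in(0,2/3)$, any initial condition $(x_{\sqrt\varepsilon},\sqrt\varepsilon)\in\mathcal D(\varrho)$ and all $t\in(\sqrt\varepsilon,T]$, the first-exit time $\tau_{\mathcal D(\varrho)}$ of $(x_s,s)$ from $\mathcal D(\varrho)$ satisfies $$\mathbb P^{\sqrt\varepsilon,x_{\sqrt\varepsilon}}\{\tau_{\mathcal D(\varrho)}\ge t\}\le C(t,\varepsilon)\frac{|\log\sigma|}{\sigma}\,\frac{e^{-\varrho\,\alpha(t,\sqrt\varepsilon)/\varepsilon}}{\sqrt{1-e^{-2\varrho\,\alpha(t,\sqrt\varepsilon)/\varepsilon}}},\qquad C(t,\varepsilon)=c\,\mu(t)\Bigl(1+\frac{\alpha(t,\sqrt\varepsilon)}{\varepsilon}\Bigr),$$ for some constant $c>0$.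
   Context: $W_t$ standard Brownian motion; $\varepsilon,\sigma>0$ small. The set $\mathcal D(2/3)$ contains the points where the potential $V(x,t)=\tfrac14x^4-\tfrac12\mu(t)x^2$ is concave, and $\mathcal D(0)$ the points between the bottoms of the two wells. *)

(* Defs.v *)
From HB Require Import structures.
From mathcomp Require Import all_boot all_order all_algebra.
From mathcomp Require Import all_classical all_reals all_analysis.
Set Implicit Arguments. Unset Strict Implicit. Unset Printing Implicit Defensive.
Import Order.TTheory GRing.Theory Num.Theory.
Import numFieldNormedType.Exports.
Local Open Scope classical_set_scope.
Local Open Scope ring_scope.

Section defs.
Context {R : realType}.

(* Standard Brownian motion on [0, +oo) on the probability space P:
   W 0 = 0, every path continuous on [0,+oo), increments W t - W s (0 <= s < t)
   are N(0, t - s) (normal_prob takes the standard deviation), and increments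
   over successive disjoint intervals are mutually independent. *)
Definition brownian_motion {d : measure_display} {Omega : measurableType d}
    (P : probability Omega R) (W : R -> Omega -> R) : Prop :=
  [/\ (forall t, 0 <= t -> measurable_fun setT (W t)),
      (forall w, W 0 w = 0),
      (forall w, {within [set t : R | 0 <= t], continuous (fun t => W t w)}),
      (forall s t (A : set R), 0 <= s -> s < t -> measurable A ->
         P [set w | A (W t w - W s w)] = normal_prob 0 (Num.sqrt (t - s)) A) &
      (forall (n : nat) (ts : nat -> R) (A : nat -> set R),
         0 <= ts 0%N -> (forall i, (i < n)%N -> ts i < ts i.+1) ->
         (forall i, measurable (A i)) ->
         P [set w | forall i, (i < n)%N -> A i (W (ts i.+1) w - W (ts i) w)] =
         (\prod_(i < n) P [set w | A i (W (ts i.+1) w - W (ts i) w)%R])%E)].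

Definition alpha (mu : R -> R) (t s : R) : R :=
  \int[lebesgue_measure]_(u in `[s, t]) mu u.

Definition inD (eps T rho : R) (mu : R -> R) (x t : R) : Prop :=
  Num.sqrt eps <= t <= T /\ `|x| <= Num.sqrt ((1 - rho) * mu t).

(* x is (pathwise) a solution on [sqrt eps, T] of
   dx = (1/eps)(mu x - x^3) dt + (sig/sqrt eps) dW, started at x0 at time sqrt eps.
   The noise is additive, so the SDE is the pathwise integral equation below. *)
Definition sde_solution {Omega : Type} (eps sig T : R) (mu : R -> R)
    (W : R -> Omega -> R) (x0 : R) (x : R -> Omega -> R) : Prop :=
  forall w,
    {within `[Num.sqrt eps, T], continuous (fun s => x s w)} /\
    forall s, Num.sqrt eps <= s <= T ->
      x s w = x0 + eps^-1 * (\int[lebesgue_measure]_(u in `[Num.sqrt eps, s])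
                                (mu u * x u w - x u w ^+ 3))
              + sig / Num.sqrt eps * (W s w - W (Num.sqrt eps) w).

Definition exit_time {Omega : Type} (eps T rho : R) (mu : R -> R)
    (x : R -> Omega -> R) (w : Omega) : \bar R :=
  ereal_inf [set s%:E | s in [set s : R | Num.sqrt eps <= s /\
                                          ~ inD eps T rho mu (x s w) s]].

End defs.

(* Main.v *)
(* Inside D(rho) the drift of |x| is at least rho * mu(t) * |x|, so |x_t| should
   dominate the modulus of the linear process dz = rho mu z dt / eps + noise, a
   Gaussian variable of variance about
   sigma^2 (exp(2 rho alpha / eps) - 1) / (2 rho mu(t)); the probability that it
   is at most sqrt(mu(t)) gives the bound.  No stochastic calculus is needed:
   replace the drift outside D(rho) so that it is expanding everywhere, and run
   the Euler scheme X_(k+1) = g_k(X_k) + kappa xi_k, |g_k(x)| >= m_k |x|.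
   Convolving with a Gaussian preserves the functions exp(-x^2 / (2 S)), and these
   decrease in |x|; hence E exp(-X_n^2 / (2 S)) <= sqrt(S / (S + V_n)), V_n being
   the variance of the linear scheme.  On the event that x stays in D(rho) up to t,
   x solves the modified equation pathwise, so X_n -> x_t, and the bound passes to
   the limit.  The same convergence, for the original drift, shows that x_t, hence
   the exit event, is measurable. *)
Require Import Defs.
From HB Require Import structures.
From mathcomp Require Import all_boot all_order all_algebra.
From mathcomp Require Import all_classical all_reals all_analysis.
From mathcomp Require Import measurable_realfun ring lra.
Import Order.TTheory GRing.Theory Num.Theory.
Import numFieldNormedType.Exports.
Local Open Scope classical_set_scope.
Local Open Scope ring_scope.

Set Implicit Arguments.
Unset Strict Implicit.
Unset Printing Implicit Defensive.

(** * Calculus on a segment *)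

Section calculus.
Context {R : realType}.
Implicit Types (a b : R) (f : R -> R).

(** Heine-Cantor theorem: each point has a radius that works for [e / 2], and compactness in
    near-covering form makes half of it uniform by the triangle inequality. The uniform modulus
    drives the error estimate of the Euler scheme. *)
Lemma within_itv_continuousP a b f : {within `[a, b], continuous f} <->
  forall e : R, 0 < e -> exists2 d : R, 0 < d &
    forall x y : R, a <= x <= b -> a <= y <= b -> `|x - y| < d ->
      `|f x - f y| < e.
Proof.
split=> [cf e e0|cf].
  have := (@segment_compact R a b); rewrite compact_near_coveringP.
  rewrite -near_covering_withinP.
  move=> /(_ _ (0^'+) (fun d x => forall y, a <= y <= b -> `|x - y| < d ->
      `|f x - f y| < e)) [].
    move=> x xab; have e2 : 0 < e / 2 by rewrite divr_gt0.
    move/subspace_continuousP : cf => /(_ x xab) /cvgrPdist_lt /(_ _ e2).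
    move=> [r /= r0 xr]; exists (ball x (r / 2), `]0, (r / 2)[%classic).
      split; first by exists (r / 2) => //=; rewrite divr_gt0.
      exists (r / 2) => /=; first by rewrite divr_gt0.
      by move=> z /=; rewrite sub0r normrN in_itv/= => + z0;
        rewrite z0 gtr0_norm.
    move=> [y d] /= [yx]; rewrite in_itv/= => /andP[d0 dr] yab z zab yz.
    have xy : `|x - y| < r by apply: lt_trans yx _; lra.
    have xz : `|x - z| < r.
      rewrite (_ : x - z = (x - y) + (y - z)); last by ring.
      apply: le_lt_trans (ler_normD _ _) _; move: yx; rewrite /ball/=; lra.
    have /(_ yab) := xr y xy; have /(_ _) := xr z xz.
    rewrite /= in_itv/= => /(_ zab) fz fy.
    rewrite (_ : f y - f z = (f x - f z) - (f x - f y)); last by ring.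
    by apply: le_lt_trans (ler_normB _ _) _; lra.
  move=> r /= r0 dP; exists (r / 2); first by rewrite divr_gt0.
  move=> x y xab yab xy; apply: (dP (r / 2)) => //=; last by rewrite divr_gt0.
  by rewrite sub0r normrN gtr0_norm; lra.
apply/subspace_continuousP => x xab; apply/cvgrPdist_lt => e e0.
have [d d0 fd] := cf _ e0; exists d => //= y xy yab.
by apply: fd => //; rewrite -in_itv.
Qed.

Lemma within_itvW a b c d f : a <= c -> d <= b ->
  {within `[a, b], continuous f} -> {within `[c, d], continuous f}.
Proof.
move=> ac db /within_itv_continuousP cf; apply/within_itv_continuousP => e e0.
have [r r0 fr] := cf _ e0; exists r => // x y xcd ycd.
by apply: fr; lra.
Qed.

Lemma within_itv_bounded a b f : {within `[a, b], continuous f} ->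
  exists M, forall x, a <= x <= b -> `|f x| <= M.
Proof.
have [ab cf|ab _] := leP a b; last by exists 0 => x; lra.
have [c _ fc] := EVT_max ab cf; have [d _ fd] := EVT_min ab cf.
exists (`|f c| + `|f d|) => x xab.
have xi : x \in `[a, b] by rewrite in_itv.
have := fc _ xi; have := fd _ xi.
have := ler_norm (f c); have := ler_norm (- f d); rewrite normrN.
have := normr_ge0 (f c); have := normr_ge0 (f d) => *.
by rewrite ler_norml; apply/andP; split; lra.
Qed.

Lemma within_itv_integrable a b f : {within `[a, b], continuous f} ->
  (@lebesgue_measure R).-integrable `[a, b] (EFin \o f).
Proof. by apply: continuous_compact_integrable; exact: segment_compact. Qed.

Lemma Rintegral_cst_itv a b (c : R) : a <= b ->
  \int[lebesgue_measure]_(u in `[a, b]) c = c * (b - a).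
Proof.
move=> ab; rewrite Rintegral_cst//=; congr (_ * _).
rewrite lebesgue_measure_itv/= lte_fin.
by case: ltgtP ab => // -> _; rewrite subrr.
Qed.


Lemma Rintegral_split a b c f : a <= b -> b <= c ->
  {within `[a, c], continuous f} ->
  \int[lebesgue_measure]_(u in `[a, c]) f u =
  \int[lebesgue_measure]_(u in `[a, b]) f u +
  \int[lebesgue_measure]_(u in `[b, c]) f u.
Proof.
move=> ab bc cf; have /Rintegral_itvB := within_itv_integrable cf.
move=> /(_ b); rewrite !bnd_simp ab bc => /(_ isT isT) E.
rewrite -(Rintegral_itv_obnd_cbnd (r := b)).
  by rewrite -E addrC subrK.
apply: integrableS (within_itv_integrable cf) => //.
by apply: subset_itv; rewrite bnd_simp.
Qed.

Lemma Rintegral_near_cst a b f (c e : R) : a <= b ->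
  {within `[a, b], continuous f} ->
  (forall u, a <= u <= b -> `|f u - c| <= e) ->
  `|\int[lebesgue_measure]_(u in `[a, b]) f u - c * (b - a)| <= e * (b - a).
Proof.
move=> ab cf fc.
have cst_int (k : R) : (@lebesgue_measure R).-integrable `[a, b] (EFin \o cst k).
  by apply: within_itv_integrable; apply/continuous_subspaceT => ?; exact: cvg_cst.
have fi := within_itv_integrable cf.
rewrite -!(Rintegral_cst_itv _ ab) ler_norml; apply/andP; split.
  rewrite lerBrDl -RintegralB//; try exact: cst_int.
  apply: le_Rintegral => //.
    exact: (cst_int (c - e)).
  by move=> x; rewrite /= in_itv/= => /fc; rewrite ler_norml; lra.
rewrite lerBlDl -RintegralD//; try exact: cst_int.
apply: le_Rintegral => //.
  rewrite (_ : _ \o _ = EFin \o cst (c + e))//.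
by move=> x; rewrite /= in_itv/= => /fc; rewrite ler_norml; lra.
Qed.

End calculus.

(** * Pathwise convergence of the Euler scheme *)

(** The step inequality is asked only at indices where the bound already holds. This bootstrap fits
    a drift that is merely locally Lipschitz: the Lipschitz constant is available only while the
    scheme is close to the solution. *)
Lemma discrete_gronwall (R : realType) (e : nat -> R) (p q : R) (n : nat) :
  0 <= p -> 0 <= q -> e 0%N = 0 ->
  (forall k, (k < n)%N -> e k <= q * k%:R * (1 + p) ^+ k ->
     e k.+1 <= (1 + p) * e k + q) ->
  forall k, (k <= n)%N -> e k <= q * k%:R * (1 + p) ^+ k.
Proof.
move=> p0 q0 e0 eS; elim=> [_|k IHk kn]; first by rewrite e0 mulr0 mul0r.
have ek := IHk (ltnW kn); apply: le_trans (eS _ kn ek) _.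
have p1 : 1 <= (1 + p) ^+ k.+1 by rewrite exprn_ege1 //; lra.
apply: (@le_trans _ _ ((1 + p) * (q * k%:R * (1 + p) ^+ k) + q)).
  by rewrite lerD2r ler_wpM2l //; lra.
rewrite (_ : (1 + p) * _ = q * k%:R * (1 + p) ^+ k.+1); last by rewrite exprS; ring.
by rewrite -natr1 mulrDr mulrDl lerD2l mulr1 ler_peMr.
Qed.

Section euler.
Context {R : realType}.

(** Time enters the drift only through the second argument, the value of the coefficient, so joint
    regularity in both arguments covers the time dependence too. *)
Definition locally_lipschitz (G : R -> R -> R) :=
  forall M : R, exists2 L : R, 0 <= L & forall y y' u u',
    `|y| <= M -> `|y'| <= M -> `|u| <= M -> `|u'| <= M ->
    `|G y u - G y' u'| <= L * (`|y - y'| + `|u - u'|).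

(** The coefficient is read at the right end of each step: for an increasing [mu] the resulting
    Riemann sums then exceed the integral, which is the favourable direction. The noise intensity is
    included in [w]. *)
Fixpoint euler (G : R -> R -> R) (m w : R -> R) (x0 s0 h : R) (k : nat) : R :=
  if k is k'.+1 then
    let y := euler G m w x0 s0 h k' in
    y + h * G y (m (s0 + h * k'.+1%:R)) +
    (w (s0 + h * k'.+1%:R) - w (s0 + h * k'%:R))
  else x0.

Variables (G : R -> R -> R) (m x w : R -> R) (s0 t x0 : R).
Hypothesis lipG : locally_lipschitz G.
Hypothesis s0t : s0 <= t.
Hypothesis cm : {within `[s0, t], continuous m}.
Hypothesis cx : {within `[s0, t], continuous x}.

Lemma segment_bound : exists2 M : R, 0 <= M &
  forall s, s0 <= s <= t -> `|x s| <= M /\ `|m s| <= M.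
Proof.
have [M Mx] := within_itv_bounded cx; have [M' Mm] := within_itv_bounded cm.
exists (`|M| + `|M'|) => // s st; split.
  by rewrite (le_trans (Mx _ st))// ler_wpDr// ler_norm.
by rewrite (le_trans (Mm _ st))// ler_wpDl// ler_norm.
Qed.

Lemma drift_continuous : {within `[s0, t], continuous (fun u => G (x u) (m u))}.
Proof.
have [M M0 xmM] := segment_bound; have [L L0 LG] := lipG M.
apply/within_itv_continuousP => e e0.
have L1 : 0 < 2 * (L + 1) by lra.
have e1 : 0 < e / (2 * (L + 1)) by rewrite divr_gt0.
have /within_itv_continuousP /(_ _ e1) [d d0 xd] := cx.
have /within_itv_continuousP /(_ _ e1) [d' d'0 md] := cm.
exists (Num.min d d'); first by rewrite lt_min d0.
move=> u v ut vt; rewrite lt_min => /andP[uvd uvd'].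
have [xu mu] := xmM _ ut; have [xv mv] := xmM _ vt.
apply: le_lt_trans (LG _ _ _ _ xu xv mu mv) _.
have := xd _ _ ut vt uvd; have := md _ _ ut vt uvd'.
set D := e / _; have -> : e = 2 * (L + 1) * D by rewrite /D mulrC divfK// gt_eqF.
move: (`|_ - _|) (`|_ - _|) => a b ab bb.
apply: (@le_lt_trans _ _ (L * (2 * D))); first by rewrite ler_wpM2l//; move: ab bb; lra.
by rewrite mulrA ltr_pM2r//; lra.
Qed.

Hypothesis xE : forall s, s0 <= s <= t ->
  x s = x0 + \int[lebesgue_measure]_(u in `[s0, s]) G (x u) (m u) + (w s - w s0).

Lemma solution_increment s s' : s0 <= s -> s <= s' -> s' <= t ->
  x s' - x s = \int[lebesgue_measure]_(u in `[s, s']) G (x u) (m u) + (w s' - w s).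
Proof.
move=> s0s ss' s't; rewrite !xE; [|lra|lra].
rewrite (Rintegral_split s0s ss'); first by ring.
exact: within_itvW drift_continuous.
Qed.

(** The additive noise is reproduced exactly by the scheme, so the error obeys a deterministic
    recursion [E (k+1) <= (1 + h L) E k + h L (r + r)], where [r] bounds the oscillation of [x] and
    of [m] over one step. Gronwall concludes. *)
Lemma euler_cvg :
  euler G m w x0 s0 ((t - s0) / n%:R) n @[n --> \oo] --> x t.
Proof.
have [M M0 xmM] := segment_bound; have [L L0 LG] := lipG (M + 1).
pose T := t - s0; have T0 : 0 <= T by rewrite subr_ge0.
(* [B * r] is the final Gronwall bound: total time [T], growth factor [expR (L * T)], and two
   oscillations, each weighted by [L]. *)
pose B := T * expR (L * T) * (2 * L); have B0 : 0 <= B.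
  by rewrite /B !mulr_ge0// expR_ge0.
(* With [e <= 1] the scheme stays in the box of radius [M + 1], on which [L] was chosen. *)
suff key e : 0 < e -> e <= 1 -> \forall n \near \oo,
    `|euler G m w x0 s0 (T / n%:R) n - x t| <= e.
  apply/cvgrPdist_le => /= e e0.
  have m0 : 0 < Num.min e 1 by rewrite lt_min e0 ltr01.
  have m1 : Num.min e 1 <= 1 by rewrite ge_min lexx orbT.
  apply: filterS (key _ m0 m1) => n; rewrite distrC => /le_trans; apply.
  by rewrite ge_min lexx.
move=> e0 e1; pose r := e / (B + 1).
have r0 : 0 < r by rewrite divr_gt0//; lra.
have /within_itv_continuousP /(_ _ r0) [d d0 xd] := cx.
have /within_itv_continuousP /(_ _ r0) [d' d'0 md] := cm.
pose D := Num.min d d'; have D0 : 0 < D by rewrite lt_min d0.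
have [N TN] : exists N : nat, T / D < N%:R.
  by exists (Num.trunc (T / D)).+1; rewrite truncnS_gt// num_real.
exists N.+1 => // n /= Nn; set h := T / n%:R.
have n0 : 0 < n%:R :> R by rewrite ltr0n (leq_trans _ Nn).
have h0 : 0 <= h by rewrite /h divr_ge0// ltW.
have hn : h * n%:R = T by rewrite /h divfK// gt_eqF.
have hD : h < D.
  rewrite /h ltr_pdivrMr// mulrC -ltr_pdivrMr//; apply: lt_le_trans TN _.
  by rewrite ler_nat ltnW.
have [hd hd'] : h < d /\ h < d' by move: hD; rewrite lt_min => /andP[].
pose s k := s0 + h * k%:R.
have s_S k : s k.+1 = s k + h by rewrite /s -natr1; ring.
have sT k : (k <= n)%N -> s0 <= s k <= t.
  move=> kn; rewrite /s lerDl mulr_ge0//= -lerBrDl -/T -hn ler_wpM2l//.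
  by rewrite ler_nat.
pose X := euler G m w x0 s0 h.
pose E k := `|X k - x (s k)|.
have p0 : 0 <= h * L by rewrite mulr_ge0.
have q0 : 0 <= h * (L * (r + r)) by rewrite !mulr_ge0// addr_ge0// ltW.
have small k : (k <= n)%N ->
    h * (L * (r + r)) * k%:R * (1 + h * L) ^+ k <= e.
  move=> kn.
  have pe : (1 + h * L) ^+ k <= expR (L * T).
    apply: (@le_trans _ _ (expR (h * L) ^+ k)).
      by rewrite lerXn2r ?nnegrE ?expR_ge0 ?expR_ge1Dx//; lra.
    rewrite -expRM_natl ler_expR -hn.
    rewrite (_ : L * _ = n%:R * (h * L)); last by ring.
    by rewrite ler_wpM2r// ler_nat.
  have hk : h * k%:R <= T by rewrite -hn ler_wpM2l// ler_nat.
  rewrite (_ : h * _ * _ = h * k%:R * (L * (r + r))); last by ring.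
  apply: (@le_trans _ _ (T * (L * (r + r)) * expR (L * T))).
    apply: ler_pM => //; last 1 first.
    - by rewrite ler_wpM2r// mulr_ge0// addr_ge0// ltW.
    - by rewrite !mulr_ge0// addr_ge0// ltW.
    - by rewrite exprn_ge0//; lra.
  rewrite (_ : T * _ * _ = B * r); last by rewrite /B; ring.
  by rewrite /r mulrA ler_pdivrMr 1?mulrC ?ler_pM2l//; lra.
have Ebound : forall k, (k <= n)%N ->
    E k <= h * (L * (r + r)) * k%:R * (1 + h * L) ^+ k.
  apply: discrete_gronwall => //.
    by rewrite /E /X /s /= mulr0 addr0 xE ?lexx//= set_itv1 Rintegral_set1 !(subrr, addr0) normr0.
  move=> k kn /le_trans /(_ (small k (ltnW kn))) Ek.
  have sk := sT _ (ltnW kn); have sk1 := sT _ kn.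
  have [xk mk] := xmM _ sk; have [xk1 mk1] := xmM _ sk1.
  have Xk : `|X k| <= M + 1.
    rewrite (_ : X k = (X k - x (s k)) + x (s k)); last by ring.
    by apply: le_trans (ler_normD _ _) _; move: Ek; rewrite /E; lra.
  have inc : x (s k.+1) - x (s k) =
      \int[lebesgue_measure]_(u in `[s k, s k.+1]) G (x u) (m u) +
      (w (s k.+1) - w (s k)).
    by apply: solution_increment; rewrite ?s_S; move: sk sk1; rewrite ?s_S; lra.
  have I : `|\int[lebesgue_measure]_(u in `[s k, s k.+1]) G (x u) (m u) -
      G (x (s k)) (m (s k.+1)) * (s k.+1 - s k)| <= L * (r + r) * (s k.+1 - s k).
    apply: Rintegral_near_cst; first by rewrite s_S; lra.
      by apply: within_itvW drift_continuous; [move: sk; lra|move: sk1; lra].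
    move=> u usk; have ut : s0 <= u <= t by lra.
    have [xu mu] := xmM _ ut.
    apply: le_trans (LG _ _ _ _ _ _ _ _) _; try lra.
    apply: ler_wpM2l => //; apply: lerD; apply: ltW.
      by apply: xd => //; rewrite ger0_norm; move: usk; rewrite s_S; lra.
    by apply: md => //; rewrite distrC ger0_norm; move: usk; rewrite s_S; lra.
  have J : `|G (X k) (m (s k.+1)) - G (x (s k)) (m (s k.+1))| <= L * E k.
    apply: le_trans (LG _ _ _ _ _ _ _ _) _; try lra.
    by rewrite subrr normr0 addr0.
  have hs : s k.+1 - s k = h by rewrite s_S; ring.
  rewrite hs in I; rewrite /E.
  (* New error = old error + drift difference at the grid point - quadrature error; the noise
     increments cancel. *)
  rewrite (_ : X k.+1 - _ = (X k - x (s k)) +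
    h * (G (X k) (m (s k.+1)) - G (x (s k)) (m (s k.+1))) -
    (\int[lebesgue_measure]_(u in `[s k, s k.+1]) G (x u) (m u) -
      G (x (s k)) (m (s k.+1)) * h)); last first.
    rewrite (_ : x (s k.+1) = x (s k) + (x (s k.+1) - x (s k))); last by ring.
    rewrite inc /X /= -/X -/(s k.+1) -/(s k); ring.
  apply: le_trans (ler_normB _ _) _.
  apply: le_trans (lerD (ler_normD _ _) I) _.
  have J' := ler_wpM2l h0 J; rewrite normrM (ger0_norm h0) -/(E k).
  by move: J'; lra.
have := le_trans (Ebound _ (leqnn n)) (small _ (leqnn n)).
by rewrite /E /s hn /T [s0 + _]addrC subrK.
Qed.

End euler.

(** * Independence along a recursion *)

Section independence.
Context {R : realType} {d : measure_display} {Omega : measurableType d}.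
Variable P : probability Omega R.
Local Open Scope ereal_scope.

(** When [P D] is nonzero, the law of the pair restricted to [D] and divided by [P D] agrees with
    the product measure on rectangles, hence everywhere by uniqueness. When [P D] vanishes both
    sides are zero. *)
Lemma joint_law (X Y : {mfun Omega >-> R}) (D : set Omega) :
  measurable D ->
  (forall A B : set R, measurable A -> measurable B ->
     P (X @^-1` A `&` Y @^-1` B `&` D) =
     P (X @^-1` A) * P (Y @^-1` B) * P D) ->
  forall S : set (R * R), measurable S ->
    P ((fun w => (X w, Y w)) @^-1` S `&` D) =
    (distribution P X \x distribution P Y) S * P D.
Proof.
move=> mD XYD S mS.
pose XY w := (X w, Y w).
have mXY : measurable_fun setT XY by exact: measurable_fun_pair.
have mXYS : measurable (XY @^-1` S) by rewrite -[X in measurable X]setTI; exact: mXY.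
have PD : P D \is a fin_num by rewrite fin_num_measure.
have [D0|D0] := eqVneq (P D) 0.
  rewrite D0 mule0; apply/eqP; rewrite -measure_le0 -[leRHS]D0.
  by apply: le_measure; rewrite ?inE//; exact: measurableI.
pose c := (fine (P D))^-1%R.
have c0 : (0 <= c)%R by rewrite invr_ge0 fine_ge0.
have cD : c%:E * P D = 1.
  by rewrite -(fineK PD) -EFinM mulVf// fine_eq0.
pose m' := mscale (NngNum c0) (pushforward (mrestr P mD) XY).
have m'E (A B : set R) : measurable A -> measurable B ->
    m' mXY (A `*` B) = distribution P X A * distribution P Y B.
  move=> mA mB; rewrite /m' /mscale/= /pushforward /mrestr.
  have -> : XY @^-1` (A `*` B) `&` D = X @^-1` A `&` Y @^-1` B `&` D by [].
  by rewrite XYD// muleCA cD mule1.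
rewrite (product_measure_unique m'E)// /m' /mscale/= /pushforward /mrestr/=.
by rewrite [X in _ = X]muleC muleA [P D * _]muleC cD mul1e.
Qed.

Lemma expectation_joint (X Y : {mfun Omega >-> R}) (f : R * R -> \bar R) :
  (forall A B : set R, measurable A -> measurable B ->
     P (X @^-1` A `&` Y @^-1` B) = P (X @^-1` A) * P (Y @^-1` B)) ->
  measurable_fun setT f -> (forall p, 0 <= f p) ->
  \int[P]_w f (X w, Y w) = \int[P]_w \int[distribution P Y]_y f (X w, y).
Proof.
move=> XY mf f0.
have mXY : measurable_fun setT (fun w => (X w, Y w)).
  exact: measurable_fun_pair.
transitivity (\int[pushforward P (fun w => (X w, Y w))]_p f p).
  by rewrite ge0_integral_pushforward.
transitivity (\int[distribution P X \x distribution P Y]_p f p).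
  apply: eq_measure_integral => S mS _; rewrite -[RHS]mule1.
  rewrite -(probability_setT P) -joint_law ?setIT// => A B mA mB.
  by rewrite setIT XY// probability_setT mule1.
rewrite fubini_tonelli1// ge0_integral_distribution//.
- exact: measurable_fun_fubini_tonelli_F.
- by move=> x; exact: integral_ge0.
Qed.

(* Independence of the whole family is propagated along the recursion by
   keeping track of the future increments [xi i], [k <= i < n]. *)
Variables (n : nat) (xi X : nat -> {mfun Omega >-> R}).
Variables (f : nat -> R * R -> R) (x0 : R).
Hypothesis mf : forall k, measurable_fun setT (f k).
Hypothesis X0 : forall w, X 0%N w = x0.
Hypothesis XS : forall k w, X k.+1 w = f k (X k w, xi k w).
Hypothesis xi_indep : forall A : nat -> set R, (forall i, measurable (A i)) ->
  P [set w | forall i, (i < n)%N -> A i (xi i w)] =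
  \prod_(i < n) P [set w | A i (xi i w)].

Let future k (A : nat -> set R) :=
  [set w | forall i, (k <= i < n)%N -> A i (xi i w)].

Let measurable_future k A : (forall i, measurable (A i)) ->
  measurable (future k A).
Proof.
move=> mA; rewrite (_ : future k A =
    \bigcap_i (if (k <= i < n)%N then xi i @^-1` A i else setT)); last first.
  apply/seteqP; split => [w Fw i _|w Fw i kin].
    by case: ifPn => // /Fw.
  by have := Fw i I; rewrite kin.
apply: bigcapT_measurable => i; case: ifPn => // _.
exact: measurable_funPTI.
Qed.

(** Mutual independence is applied to the family [A' C], trivial before [k], equal to [C] at [k] and
    to [A] afterwards. The choices [C = B] and [C = setT] share the product over the other indices,
    which is therefore the probability of the future event. *)
Let futureE k A (B : set R) : (k < n)%N -> (forall i, measurable (A i)) ->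
  measurable B ->
  P (xi k @^-1` B `&` future k.+1 A) = P (xi k @^-1` B) * P (future k.+1 A).
Proof.
move=> kn mA mB.
pose A' (C : set R) i := if (i < k)%N then setT else if i == k then C else A i.
have mA' C : measurable C -> forall i, measurable (A' C i).
  by move=> mC i; rewrite /A'; case: ifP => // _; case: ifP.
have A'E C : xi k @^-1` C `&` future k.+1 A =
    [set w | forall i, (i < n)%N -> A' C i (xi i w)].
  apply/seteqP; split => [w [/= Cw Fw] i lin|w Aw].
    rewrite /A'; case: ltngtP => // [ki|->//].
    by apply: Fw; rewrite ki.
  split=> [|i /andP[ki lin]]; first by have := Aw k kn; rewrite /A' ltnn eqxx.
  by have := Aw i lin; rewrite /A' ltnNge (ltnW ki)/= gtn_eqF.
have A'P C : measurable C -> P (xi k @^-1` C `&` future k.+1 A) =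
    P (xi k @^-1` C) * \prod_(i < n | i != Ordinal kn) P [set w | A' setT i (xi i w)].
  move=> mC; rewrite A'E xi_indep; last exact: mA'.
  rewrite (bigD1 (Ordinal kn))//=; congr (_ * _).
    by congr (P _); apply/seteqP; split => w; rewrite /= /A' ltnn eqxx.
  apply: eq_bigr => i ik; congr (P _); apply/seteqP.
  have {}ik : i != k :> nat by apply: contra ik => /eqP ik; apply/eqP/val_inj.
  by split => w; rewrite /= /A' (negbTE ik).
rewrite A'P//; congr (_ * _).
have := A'P setT measurableT.
by rewrite preimage_setT setTI probability_setT mul1e => ->.
Qed.

Lemma markov_independence k : (k <= n)%N ->
  forall (C : set R) (A : nat -> set R), measurable C ->
  (forall i, measurable (A i)) ->
  P (X k @^-1` C `&` [set w | forall i, (k <= i < n)%N -> A i (xi i w)]) =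
  P (X k @^-1` C) *
  P [set w | forall i, (k <= i < n)%N -> A i (xi i w)].
Proof.
elim: k => [_ C A mC mA|k IHk kn C A mC mA]; rewrite -/(future _ A).
  have [Cx0|nCx0] := pselect (C x0).
    rewrite (_ : X 0 @^-1` C = setT) ?setTI ?probability_setT ?mul1e//.
    by apply/seteqP; split => w //= _; rewrite X0.
  rewrite (_ : X 0 @^-1` C = set0) ?set0I ?measure0 ?mul0e//.
  by apply/seteqP; split => w //=; rewrite X0.
(* Taking [B'] as the set at index [k] in the induction hypothesis makes [X k], [xi k] and the later
   increments jointly independent; [joint_law] then passes from rectangles to the preimage of [C]
   under [f k]. *)
have indep (A' : nat -> set R) : (forall i, measurable (A' i)) ->
    forall B B' : set R, measurable B -> measurable B' ->
    P (X k @^-1` B `&` xi k @^-1` B' `&` future k.+1 A') =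
    P (X k @^-1` B) * P (xi k @^-1` B') * P (future k.+1 A').
  move=> mA' B B' mB mB'; rewrite -muleA -futureE// -setIA.
  pose A'' i := if i == k then B' else A' i.
  have -> : xi k @^-1` B' `&` future k.+1 A' = future k A''.
    apply/seteqP; split => [w [/= Bw Fw] i /andP[]|w Fw].
      rewrite leq_eqVlt /A'' => /predU1P[<- _|ki lin]; first by rewrite eqxx.
      by rewrite gtn_eqF//; apply: Fw; rewrite ki.
    split=> [|i /andP[ki lin]]; first by have := Fw k; rewrite /A'' leqnn kn eqxx; exact.
    by have := Fw i; rewrite /A'' (ltnW ki) lin gtn_eqF//; exact.
  by apply: IHk => //; [exact: ltnW|move=> i; rewrite /A''; case: ifP].
have mS : measurable (f k @^-1` C) by rewrite -[X in measurable X]setTI; exact: mf.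
have XSE D : X k.+1 @^-1` C `&` D =
    (fun w => (X k w, xi k w)) @^-1` (f k @^-1` C) `&` D.
  by apply/seteqP; split => w [/= Cw Dw]; split => //=; move: Cw; rewrite XS.
rewrite XSE joint_law//; [|exact: measurable_future|exact: indep].
congr (_ * _); rewrite -[X k.+1 @^-1` C]setIT XSE joint_law//.
  by rewrite probability_setT mule1.
move=> B B' mB mB'.
have := indep (fun=> setT) (fun=> measurableT) _ _ mB mB'.
by rewrite (_ : future _ _ = setT)//; apply/seteqP; split.
Qed.

Lemma markov_step_independence k (A B : set R) : (k < n)%N ->
  measurable A -> measurable B ->
  P (X k @^-1` A `&` xi k @^-1` B) = P (X k @^-1` A) * P (xi k @^-1` B).
Proof.
move=> kn mA mB.
have := markov_independence (ltnW kn) mA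
  (A := fun i => if i == k then B else setT) _.
rewrite (_ : [set w | _] = xi k @^-1` B); first by apply => i; case: ifP.
apply/seteqP; split => [w /(_ k)|w Bw i _]; first by rewrite leqnn kn eqxx; exact.
by case: eqP => // ->.
Qed.

End independence.

(** * Gaussian convolution *)

Section gaussian.
Context {R : realType}.
Local Notation lebesgue := (@lebesgue_measure R).

(** The Radon-Nikodym derivative of [normal_prob] equals [normal_pdf] almost everywhere, both having
    the same integral over every measurable set. *)
Lemma integral_normal_probE (m s : R) (f : R -> \bar R) :
  measurable_fun setT f ->
  (\int[normal_prob m s]_x `|f x| < +oo)%E ->
  (\int[normal_prob m s]_x f x =
   \int[lebesgue]_x (f x * (normal_pdf m s x)%:E))%E.
Proof.
move=> mf finf; have dom := normal_prob_dominates m s.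
rewrite -(Radon_Nikodym_change_of_variables dom)//=; last first.
  by apply/integrableP; split.
apply: ae_eq_integral => //.
- apply: emeasurable_funM => //; exact: (measurable_int lebesgue).
- apply: emeasurable_funM => //=; apply/measurableT_comp => //=.
  exact: measurable_normal_pdf.
- apply: ae_eqe_mul2l => /=.
  rewrite Radon_NikodymE//=; case: cid => /= h [h1 h2 h3].
  apply: integral_ae_eq => //=.
  + by apply/measurableT_comp => //; exact: measurable_normal_pdf.
  + by move=> E E01 mE; rewrite -h3.
Qed.

(* [normal_prob] lives on [measurableTypeR R], whose canonical structure is not
   the one found for [R]; the identity map transports integrals. *)
Lemma integral_normal_law (h : R) (Q : {measure set R -> \bar R})
  (f : R -> \bar R) :
  (forall A : set R, measurable A -> Q A = normal_prob 0 (Num.sqrt h) A) ->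
  measurable_fun setT f -> (forall x, 0 <= f x)%E ->
  (\int[Q]_z f z = \int[normal_prob 0 (Num.sqrt h)]_z f z)%E.
Proof.
move=> QE mf f0.
have mid : @measurable_fun _ _ R (measurableTypeR R) setT idfun.
  by move=> _ A mA; rewrite setTI.
transitivity (\int[pushforward Q (idfun : R -> measurableTypeR R)]_z f z)%E.
  have := ge0_integral_pushforward mid Q measurableT mf.
  by rewrite /= preimage_setT => ->.
by apply: eq_measure_integral => A mA _; exact: QE.
Qed.

Definition gauss (S x : R) := expR (- (x ^+ 2 / (2 * S))).

Lemma gauss_ge0 S x : 0 <= gauss S x. Proof. exact: expR_ge0. Qed.

Lemma gauss_le1 S x : 0 <= S -> gauss S x <= 1.
Proof.
by move=> S0; rewrite -expR0 ler_expR oppr_le0 divr_ge0 ?sqr_ge0 ?mulr_ge0.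
Qed.

Lemma measurable_gauss S : measurable_fun setT (gauss S).
Proof.
apply: measurableT_comp => //; apply: measurableT_comp => //.
by apply: measurable_funM => //; exact: measurable_funX.
Qed.

Lemma gauss_mono S x y : 0 <= S -> `|x| <= `|y| -> gauss S y <= gauss S x.
Proof.
move=> S0 xy; rewrite ler_expR lerN2 ler_wpM2r ?invr_ge0 ?mulr_ge0//.
by rewrite -(real_normK (num_real x)) -(real_normK (num_real y)) ler_sqr ?nnegrE.
Qed.

(** Completing the square in [z] turns the integrand into a constant times the density of a normal
    law with mean [m] and variance [v], whose integral is 1. *)
Lemma gauss_convolution (S k h a : R) : 0 < S -> 0 < h ->
  (\int[normal_prob 0 (Num.sqrt h)]_z (gauss S (a + k * z))%:E =
   (Num.sqrt (S / (S + k ^+ 2 * h)) * gauss (S + k ^+ 2 * h) a)%:E)%E.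
Proof.
move=> S0 h0.
have mg : measurable_fun setT (fun z => gauss S (a + k * z)).
  apply: measurableT_comp; first exact: measurable_gauss.
  by apply: measurable_funD => //; exact: measurable_funM.
have Q0 : 0 < S + k ^+ 2 * h by rewrite ltr_wpDr// mulr_ge0 ?sqr_ge0// ltW.
pose v := S * h / (S + k ^+ 2 * h).
have v0 : 0 < v by rewrite divr_gt0// mulr_gt0.
pose m := - (a * k * v / S).
rewrite integral_normal_probE; [|exact/measurable_EFinP|]; last first.
  apply: (@le_lt_trans _ _ (\int[normal_prob 0 (Num.sqrt h)]_z (cst 1%E z)))%E.
    apply: ge0_le_integral => //.
      by do 2 apply: measurableT_comp => //.
    move=> z _; rewrite gee0_abs ?lee_fin ?gauss_ge0//.
    by rewrite gauss_le1// ltW.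
  rewrite integral_cst// mul1e.
  by rewrite [ltLHS](probability_setT (normal_prob 0 (Num.sqrt h))) ltry.
have sh : Num.sqrt h != 0 by rewrite gt_eqF// sqrtr_gt0.
have sv : Num.sqrt v != 0 by rewrite gt_eqF// sqrtr_gt0.
under eq_integral => z _.
  rewrite -EFinM (_ : _ * _ = (Num.sqrt (S / (S + k ^+ 2 * h)) *
    gauss (S + k ^+ 2 * h) a) * normal_pdf m (Num.sqrt v) z); last first.
    rewrite !normal_pdfE// /normal_fun /normal_peak !sqr_sqrtr ?(ltW h0) ?(ltW v0)//.
    have pi0 := pi_gt0 R; move: (pi : R) pi0 => p p0.
    have peak : Num.sqrt (h * p *+ 2)^-1 =
        Num.sqrt (S / (S + k ^+ 2 * h)) * Num.sqrt (v * p *+ 2)^-1.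
      have SQ0 : 0 <= S / (S + k ^+ 2 * h) by exact: divr_ge0 (ltW S0) (ltW Q0).
      rewrite -sqrtrM//.
      apply: (congr1 Num.sqrt); rewrite /v -[_ *+ 2]mulr_natr -[X in _ * X^-1]mulr_natr.
      move: (S + k ^+ 2 * h) Q0 => Q Q0.
      by field; rewrite !gt_eqF.
    have expo : - (a + k * z) ^+ 2 / (2 * S) - z ^+ 2 / (h *+ 2) =
        - a ^+ 2 / (2 * (S + k ^+ 2 * h)) - (z - m) ^+ 2 / (v *+ 2).
      rewrite /m /v -[h *+ 2]mulr_natr -[X in _ = _ - _ / X]mulr_natr.
      by field; rewrite !gt_eqF.
    have hp : 0 <= h * p *+ 2 by exact: mulrn_wge0 (ltW (mulr_gt0 h0 p0)).
    have vp : 0 <= v * p *+ 2 by exact: mulrn_wge0 (ltW (mulr_gt0 v0 p0)).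
    rewrite -!sqrtrV//.
    rewrite peak /gauss mulrCA [RHS]mulrACA; congr (_ * _).
    rewrite -!expRD; apply: (congr1 expR).
    by move: expo; rewrite subr0 !mulNr.
  over.
under eq_integral do rewrite EFinM.
rewrite integralZl//=; last exact: integrable_normal_pdf.
by rewrite integral_normal_pdf mule1.
Qed.

End gaussian.

(** * Small balls for expanding Gaussian schemes *)

(** Variance after [k] steps of the linear recursion with factors [m j] and independent centred
    noises of variance [q], started at a deterministic point. *)
Fixpoint scheme_var {R : realType} (m : nat -> R) (q : R) (k : nat) : R :=
  if k is k'.+1 then m k' ^+ 2 * scheme_var m q k' + q else 0.

Lemma scheme_var_ge0 (R : realType) (m : nat -> R) (q : R) k :
  0 <= q -> 0 <= scheme_var m q k.
Proof. by move=> q0; elim: k => //= k IHk; rewrite addr_ge0// mulr_ge0// sqr_ge0. Qed.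

(** The condition on [l] makes [l * (E - 1)], with [E] the product of the [(1 + y j) ^+ 2], a
    subsolution of the variance recursion. Each factor is at least [expR (2 * y j / (1 + eta))]. *)
Lemma scheme_var_lower_bound (R : realType) (y : nat -> R) (q l eta : R) (n : nat) :
  0 <= l -> 0 <= q -> 0 <= eta ->
  (forall k, (k < n)%N -> 0 <= y k <= eta /\ l * ((1 + y k) ^+ 2 - 1) <= q) ->
  forall k, (k <= n)%N ->
    l * (expR (2 / (1 + eta) * \sum_(j < k) y j) - 1) <=
    scheme_var (fun j => 1 + y j) q k.
Proof.
move=> l0 q0 eta0 yP; elim=> [_|k IHk kn] /=.
  by rewrite big_ord0 mulr0 expR0 subrr mulr0.
have [/andP[yk0 yk] lq] := yP _ kn; have IH := IHk (ltnW kn).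
rewrite big_ord_recr/= [2 / _ * _]mulrDr expRD.
set E := expR (2 / (1 + eta) * _) in IH *.
have E0 : 0 <= E by exact: expR_ge0.
have yE : expR (2 / (1 + eta) * y k) <= (1 + y k) ^+ 2.
  have -> : 2 / (1 + eta) * y k = 2%:R * (y k / (1 + eta)) by ring.
  rewrite expRM_natl lerXn2r ?nnegrE ?expR_ge0//; first lra.
  (* After inversion the claim follows from [1 / (1 + y) = 1 - y / (1 + y)] and
     [1 + z <= expR z]. *)
  rewrite -[expR _]invrK -expRN -[leRHS]invrK lef_pV2 ?posrE ?expR_gt0 ?invr_gt0; [|lra..].
  apply: le_trans (expR_ge1Dx _).
  have : y k / (1 + eta) <= y k / (1 + y k).
    by rewrite ler_wpM2l// lef_pV2 ?posrE; lra.
  have -> : y k / (1 + y k) = 1 - (1 + y k)^-1 by field; rewrite gt_eqF//; lra.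
  lra.
apply: (@le_trans _ _ (l * (E * (1 + y k) ^+ 2 - 1))).
  by rewrite ler_wpM2l// lerD2r ler_wpM2l.
have := ler_wpM2l (sqr_ge0 (1 + y k)) IH.
by move: lq; nra.
Qed.

Section gaussian_scheme.
Context {R : realType} {d : measure_display} {Omega : measurableType d}.
Variable P : probability Omega R.
Variables (n : nat) (xi X : nat -> {mfun Omega >-> R}).
Variables (g : nat -> R -> R) (m : nat -> R) (x0 kappa h : R).
Hypothesis mg : forall k, measurable_fun setT (g k).
Hypothesis X0 : forall w, X 0%N w = x0.
Hypothesis XS : forall k w, X k.+1 w = g k (X k w) + kappa * xi k w.
Hypothesis h0 : 0 < h.
Hypothesis m0 : forall k, (k < n)%N -> 0 < m k.
Hypothesis gm : forall k x, (k < n)%N -> m k * `|x| <= `|g k x|.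
Hypothesis xi_law : forall k (A : set R), (k < n)%N -> measurable A ->
  P (xi k @^-1` A) = normal_prob 0 (Num.sqrt h) A.
Hypothesis xi_indep : forall A : nat -> set R, (forall i, measurable (A i)) ->
  P [set w | forall i, (i < n)%N -> A i (xi i w)] =
  (\prod_(i < n) P [set w | A i (xi i w)])%E.

Let V := scheme_var m (kappa ^+ 2 * h).

Let measurable_gauss_comp S (Y : {mfun Omega >-> R}) :
  measurable_fun setT (fun w => (gauss S (Y w))%:E).
Proof.
apply/measurable_EFinP; apply: measurableT_comp => //.
exact: measurable_gauss.
Qed.

(** One step integrates out the noise, which widens [S] by [kappa ^+ 2 * h], then replaces [g k] by
    its linear lower bound, which divides the width by [m k ^+ 2]. The induction hypothesis is thus
    used at another width, so [S] stays quantified; the square roots telescope. *)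
Lemma expectation_gauss_le k : (k <= n)%N -> forall S, 0 < S ->
  (\int[P]_w (gauss S (X k w))%:E <= (Num.sqrt (S / (S + V k)))%:E)%E.
Proof.
have q0 : 0 <= kappa ^+ 2 * h by rewrite mulr_ge0 ?sqr_ge0// ltW.
elim: k => [_ S S0|k IHk kn S S0].
  rewrite /V /= addr0 divff ?gt_eqF// sqrtr1.
  rewrite -[leRHS](probability_setT P) -[leRHS]mul1e -integral_cst//.
  apply: ge0_le_integral => //; first by move=> w _; rewrite lee_fin gauss_ge0.
  by move=> w _; rewrite lee_fin gauss_le1// ltW.
pose F (p : R * R) := g k p.1 + kappa * p.2.
have mF : measurable_fun setT F.
  by apply: measurable_funD; [exact: measurableT_comp|exact: measurable_funM].
have indep (A B : set R) : measurable A -> measurable B ->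
    P (X k @^-1` A `&` xi k @^-1` B) = (P (X k @^-1` A) * P (xi k @^-1` B))%E.
  pose F' j (p : R * R) := g j p.1 + kappa * p.2.
  move=> mA mB; apply: (@markov_step_independence _ _ _ P n xi X F' x0) => //.
  by move=> j; apply: measurable_funD; [exact: measurableT_comp|exact: measurable_funM].
have S'0 : 0 < S + kappa ^+ 2 * h by rewrite ltr_wpDr.
have mk := m0 kn.
have -> : (\int[P]_w (gauss S (X k.+1 w))%:E =
    \int[P]_w (Num.sqrt (S / (S + kappa ^+ 2 * h)) *
      gauss (S + kappa ^+ 2 * h) (g k (X k w)))%:E)%E.
  under eq_integral do rewrite XS.
  have := @expectation_joint _ _ _ P (X k) (xi k) (fun p => (gauss S (F p))%:E) indep.
  rewrite /F /= => ->; last 2 first.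
  - apply/measurable_EFinP; apply: (measurableT_comp (measurable_gauss S)).
    exact: mF.
  - by move=> p; rewrite lee_fin gauss_ge0.
  apply: eq_integral => w _; rewrite -gauss_convolution//.
  apply: integral_normal_law => [A mA||y].
  - by rewrite -(xi_law kn mA).
  - apply/measurable_EFinP; apply: (measurableT_comp (measurable_gauss S)).
    by apply: measurable_funD => //; exact: measurable_funM.
  - by rewrite lee_fin gauss_ge0.
pose S' := (S + kappa ^+ 2 * h) / m k ^+ 2.
have S'p : 0 < S' by rewrite divr_gt0// exprn_gt0.
apply: (@le_trans _ _ (\int[P]_w ((Num.sqrt (S / (S + kappa ^+ 2 * h)))%:E *
    (gauss S' (X k w))%:E)))%E.
  apply: ge0_le_integral => //.
  - by move=> w _; rewrite lee_fin mulr_ge0 ?sqrtr_ge0 ?gauss_ge0.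
  - apply/measurable_EFinP; apply: measurable_funM => //.
    apply: measurableT_comp; first exact: measurable_gauss.
    exact: measurableT_comp.
  - by apply: emeasurable_funM => //; exact: measurable_gauss_comp.
  - move=> w _; rewrite -EFinM lee_fin ler_wpM2l ?sqrtr_ge0//.
    rewrite (_ : gauss S' (X k w) = gauss (S + kappa ^+ 2 * h) (m k * X k w)).
      apply: gauss_mono; first exact: ltW.
      by rewrite normrM gtr0_norm// gm.
    rewrite /gauss /S'; congr (expR (- _)); field.
    by rewrite !gt_eqF.
rewrite ge0_integralZl//; last first.
  by move=> w _; rewrite lee_fin gauss_ge0.
apply: (@le_trans _ _ ((Num.sqrt (S / (S + kappa ^+ 2 * h)))%:E *
    (Num.sqrt (S' / (S' + V k)))%:E))%E.
  by apply: lee_wpmul2l; rewrite ?lee_fin ?sqrtr_ge0//; exact: IHk (ltnW kn) _ S'p.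
rewrite -EFinM lee_fin -sqrtrM ?divr_ge0 ?(ltW S0) ?(ltW S'0)//.
have Vk : 0 <= V k by exact: scheme_var_ge0.
have VS : V k.+1 = m k ^+ 2 * V k + kappa ^+ 2 * h by [].
rewrite VS ler_wsqrtr// le_eqVlt; apply/orP; left; apply/eqP.
have mV : 0 <= m k ^+ 2 * V k by rewrite mulr_ge0 ?sqr_ge0.
rewrite /S'; field; rewrite !gt_eqF//=; lra.
Qed.

(** Markov inequality: on the event, [gauss (a ^+ 2)] is at least [expR (- (1 / 2))]. *)
Lemma gaussian_scheme_small_ball (a : R) : 0 < a ->
  (P [set w | (`|X n w| <= a)%R] <=
   (expR (1 / 2) * Num.sqrt (a ^+ 2 / (a ^+ 2 + V n)))%:E)%E.
Proof.
move=> a0; set A := [set w | _].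
have mA : measurable A.
  rewrite (_ : A = X n @^-1` `[- a, a]); last first.
    by apply/seteqP; split => w; rewrite /A/= in_itv/= ler_norml.
  exact: measurable_funPTI.
have a2 : 0 < a ^+ 2 by rewrite exprn_gt0.
rewrite EFinM; apply: (@le_trans _ _
    ((expR (1 / 2))%:E * \int[P]_w (gauss (a ^+ 2) (X n w))%:E))%E; last first.
  by apply: lee_wpmul2l; [rewrite lee_fin expR_ge0|exact: expectation_gauss_le].
rewrite -ge0_integralZl//; last first.
  by move=> w _; rewrite lee_fin gauss_ge0.
have -> : P A = (\int[P]_w (\1_A w)%:E)%E by rewrite integral_indic// setIT.
apply: ge0_le_integral => //.
- by apply/measurable_EFinP; exact: measurable_indic.
- by apply: emeasurable_funM => //; exact: measurable_gauss_comp.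
- move=> w _; rewrite -EFinM lee_fin indicE.
  case: (boolP (w \in A)) => [|_]; last by rewrite mulr_ge0 ?expR_ge0.
  rewrite inE /A /= => Xa.
  have Xa2 : X n w ^+ 2 <= a ^+ 2.
    by rewrite -(real_normK (num_real (X n w))) ler_sqr ?nnegrE// ltW.
  rewrite /gauss -expRD -[leLHS]expR0 ler_expR subr_ge0.
  by rewrite ler_pdivrMr ?mulr_gt0//; move: Xa2; lra.
Qed.

End gaussian_scheme.

(** * Limits of events, Riemann sums, Lipschitz drifts *)

(** The part [F N] of [E] on which every [A n] with [n >= N] holds increases to [E], and its measure
    is at most that of [A N]. *)
Lemma measure_le_liminf (R : realType) (d : measure_display)
  (Omega : measurableType d) (P : probability Omega R) (E : set Omega)
  (A : nat -> set Omega) (b : \bar R) :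
  measurable E -> (forall n, measurable (A n)) ->
  (forall w, E w -> \forall n \near \oo, A n w) ->
  (\forall n \near \oo, P (A n) <= b)%E -> (P E <= b)%E.
Proof.
move=> mE mA EA PA.
pose F N := E `&` \bigcap_(n in [set n | (N <= n)%N]) A n.
have mF N : measurable (F N).
  apply: measurableI => //; apply: bigcap_measurable => [|n _]; last exact: mA.
  by exists N => /=.
have FE : \bigcup_N F N = E.
  apply/seteqP; split => [w [N _ []]//|w Ew].
  by have [N _ NA] := EA w Ew; exists N => //; split.
have homoF : {homo F : n m / (n <= m)%N >-> (n <= m)%O}.
  move=> n m nm; apply/subsetPset; apply: setIS => w Aw k /= mk.
  exact: Aw k (leq_trans nm mk).
have := @nondecreasing_cvg_mu _ _ _ P F mF _ homoF; rewrite FE => /(_ mE) PF.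
rewrite -(cvg_lim _ PF)//; apply: lime_le; first by apply/cvg_ex; exists (P E).
apply: filterS2 PA (nbhs_infty_ge 0) => n PAn _.
apply: le_trans PAn; apply: le_measure; rewrite ?inE//.
by move=> w [_]; apply => /=.
Qed.

Lemma right_sum_ge_integral (R : realType) (f : R -> R) (a h : R) (n : nat) :
  0 <= h -> {within `[a, a + h * n%:R], continuous f} ->
  (forall u v, a <= u -> u <= v -> v <= a + h * n%:R -> f u <= f v) ->
  \int[lebesgue_measure]_(u in `[a, a + h * n%:R]) f u <=
  \sum_(k < n) h * f (a + h * k.+1%:R).
Proof.
move=> h0; elim: n => [|n IHn] cf mf.
  by rewrite big_ord0 mulr0 addr0 set_itv1 Rintegral_set1.
have an : a <= a + h * n%:R by rewrite lerDl mulr_ge0.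
have nS : a + h * n.+1%:R = a + h * n%:R + h by rewrite -natr1; ring.
have nSn : a + h * n%:R <= a + h * n.+1%:R by rewrite nS lerDl.
rewrite (Rintegral_split an nSn cf) big_ord_recr/=; apply: lerD.
  apply: IHn; first by apply: within_itvW cf.
  by move=> u v au uv vn; apply: mf => //; apply: le_trans nSn.
have cf' : {within `[a + h * n%:R, a + h * n.+1%:R], continuous f}.
  by apply: within_itvW cf.
rewrite [leRHS](_ : _ = f (a + h * n.+1%:R) * (a + h * n.+1%:R - (a + h * n%:R))).
  rewrite -(Rintegral_cst_itv _ nSn); apply: le_Rintegral => //.
  - exact: within_itv_integrable.
  - apply: within_itv_integrable; apply/continuous_subspaceT => ?; exact: cvg_cst.
  - move=> u; rewrite /= in_itv/= => /andP[nu un]; apply: mf => //.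
    exact: le_trans nu.
by rewrite nS; ring.
Qed.

Section lipschitz.
Context {R : realType}.

Lemma locally_lipschitzZ (G : R -> R -> R) (c : R) : locally_lipschitz G ->
  locally_lipschitz (fun y u => c * G y u).
Proof.
move=> lG M; have [L L0 LG] := lG M; exists (`|c| * L); first exact: mulr_ge0.
move=> y y' u u' yM y'M uM u'M.
by rewrite -mulrBr normrM -mulrA ler_wpM2l// LG.
Qed.

Lemma locally_lipschitz_pitchfork :
  locally_lipschitz (fun y u : R => u * y - y ^+ 3).
Proof.
move=> M; exists (`|M| + 3 * `|M| ^+ 2).
  by rewrite addr_ge0// mulr_ge0// exprn_ge0.
move=> y y' u u' yM y'M uM u'M.
have [{}yM {}y'M {}uM] : [/\ `|y| <= `|M|, `|y'| <= `|M| & `|u| <= `|M|].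
  by split; apply: le_trans (ler_norm M).
have -> : u * y - y ^+ 3 - (u' * y' - y' ^+ 3) =
  u * (y - y') + (u - u') * y' - (y - y') * (y ^+ 2 + y * y' + y' ^+ 2) by ring.
apply: le_trans (ler_normB _ _) _; rewrite [`|_ * (_ + _)|]normrM.
have H1 : `|u * (y - y') + (u - u') * y'| <= `|M| * (`|y - y'| + `|u - u'|).
  apply: le_trans (ler_normD _ _) _; rewrite !normrM mulrDr [`|u - u'| * _]mulrC.
  by apply: lerD; rewrite ler_wpM2r.
have H2 : `|y ^+ 2 + y * y' + y' ^+ 2| <= 3 * `|M| ^+ 2.
  rewrite (_ : 3 * _ = `|M| ^+ 2 + `|M| * `|M| + `|M| ^+ 2); last by ring.
  apply: le_trans (ler_normD _ _) _; apply: lerD.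
    apply: le_trans (ler_normD _ _) _; apply: lerD.
      by rewrite normrX lerXn2r ?nnegrE.
    by rewrite normrM ler_pM.
  by rewrite normrX lerXn2r ?nnegrE.
apply: le_trans (lerD H1 (ler_wpM2l (normr_ge0 (y - y')) H2)) _.
have := mulr_ge0 (sqr_ge0 `|M|) (normr_ge0 (u - u')).
by move: (`|y - y'|) (`|u - u'|) (`|M|) => p q r; nra.
Qed.

(* Coincides with the pitchfork drift wherever [y ^+ 2 <= (1 - rho) * u], but
   is at least the linear drift [rho * u * y] on the whole half-line. *)
Definition expanding_drift (rho y u : R) := y * Num.max (u - y ^+ 2) (rho * u).

Lemma normr_maxB (a b c e : R) :
  `|Num.max a b - Num.max c e| <= `|a - c| + `|b - e|.
Proof.
have := ler_norm (a - c); have := ler_norm (b - e).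
have := ler_norm (c - a); have := ler_norm (e - b).
rewrite [`|c - a|]distrC [`|e - b|]distrC => *.
by rewrite ler_norml; apply/andP; split;
  case: (leP a b) => *; case: (leP c e) => *; lra.
Qed.

Lemma locally_lipschitz_expanding_drift (rho : R) : 0 <= rho <= 1 ->
  locally_lipschitz (expanding_drift rho).
Proof.
move=> /andP[rho0 rho1] M; exists (2 * `|M| + 3 * `|M| ^+ 2).
  by rewrite addr_ge0// mulr_ge0// exprn_ge0.
move=> y y' u u' yM y'M uM u'M; rewrite /expanding_drift.
have [{}yM {}y'M {}uM] : [/\ `|y| <= `|M|, `|y'| <= `|M| & `|u| <= `|M|].
  by split; apply: le_trans (ler_norm M).
set m := Num.max _ _; set m' := Num.max _ _.
have mM : `|m| <= `|M| + `|M| ^+ 2.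
  have -> : m = m - Num.max 0 0 by rewrite maxxx subr0.
  have y2 : `|y| ^+ 2 <= `|M| ^+ 2 by rewrite lerXn2r ?nnegrE.
  rewrite /m /Num.max; case: ifP => _; rewrite ltxx subr0.
    by rewrite normrM (ger0_norm rho0); move: uM (normr_ge0 u) (sqr_ge0 `|M|); nra.
  by apply: le_trans (ler_normB _ _) _; rewrite normrX; lra.
have mm' : `|m - m'| <= 2 * `|u - u'| + 2 * `|M| * `|y - y'|.
  apply: le_trans (normr_maxB _ _ _ _) _.
  rewrite -mulrBr normrM (ger0_norm rho0).
  have -> : u - y ^+ 2 - (u' - y' ^+ 2) = u - u' - (y - y') * (y + y') by ring.
  have H1 : `|u - u' - (y - y') * (y + y')| <= `|u - u'| + `|y - y'| * (2 * `|M|).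
    apply: le_trans (ler_normB _ _) _; rewrite normrM lerD2l ler_wpM2l//.
    by apply: le_trans (ler_normD _ _) _; lra.
  by move: H1 (normr_ge0 (u - u')); nra.
have -> : y * m - y' * m' = (y - y') * m + y' * (m - m') by ring.
apply: le_trans (ler_normD _ _) _; rewrite !normrM.
have H1 := ler_wpM2l (normr_ge0 (y - y')) mM.
have H2 : `|y'| * `|m - m'| <= `|M| * (2 * `|u - u'| + 2 * `|M| * `|y - y'|).
  by rewrite ler_pM.
apply: le_trans (lerD H1 H2) _.
move: (normr_ge0 (y - y')) (normr_ge0 (u - u')) (normr_ge0 M).
move: (`|y - y'|) (`|u - u'|) (`|M|) => p q r p0 q0 r0.
have := mulr_ge0 r0 p0; have := mulr_ge0 (sqr_ge0 r) q0.
by nra.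
Qed.

Lemma locally_lipschitz_parabola (c : R) :
  locally_lipschitz (fun y u : R => y ^+ 2 - c * u).
Proof.
move=> M; exists (2 * `|M| + `|c|); first by rewrite addr_ge0// mulr_ge0.
move=> y y' u u' yM y'M _ _.
have -> : y ^+ 2 - c * u - (y' ^+ 2 - c * u') =
  (y - y') * (y + y') - c * (u - u') by ring.
apply: le_trans (ler_normB _ _) _; rewrite !normrM.
have yy : `|y + y'| <= 2 * `|M|.
  by apply: le_trans (ler_normD _ _) _; move: (ler_norm M); lra.
have := ler_wpM2l (normr_ge0 (y - y')) yy.
have := mulr_ge0 (normr_ge0 c) (normr_ge0 (y - y')).
have := mulr_ge0 (normr_ge0 M) (normr_ge0 (u - u')).
by move: (`|c|) (`|M|) (`|y - y'|) (`|u - u'|) => *; nra.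
Qed.

End lipschitz.

(** * Measurability of the exit event *)

(** A positive value would persist at a nearby rational. The right end [b] is not tested, because an
    exit time at least [t] constrains only the times before [t]; continuity recovers the end
    point. *)
Lemma le0_of_rational (R : realType) (a b : R) (f : R -> R) : a < b ->
  {within `[a, b], continuous f} ->
  (forall q : rat, a <= ratr q < b -> f (ratr q) <= 0) ->
  forall s, a <= s <= b -> f s <= 0.
Proof.
move=> ab cf fq s sab; rewrite leNgt; apply/negP => fs0.
have /within_itv_continuousP /(_ _ fs0) [e e0 fe] := cf.
have [q qs] : exists q : rat, a <= ratr q < b /\ `|s - ratr q| < e.
  have [sb|bs] := ltP s b.
    have : s < Num.min (s + e) b by rewrite lt_min sb ltrDl e0.
    move=> /rat_in_itvoo [q]; rewrite in_itv/= lt_min => /andP[sq /andP[qe qb]].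
    exists q; split; first by move: sab => /andP[]; lra.
    by rewrite ltr_norml; apply/andP; split; lra.
  have : Num.max (s - e) a < s by rewrite gt_max gtrBl e0/=; move: sab; lra.
  move=> /rat_in_itvoo [q]; rewrite in_itv/= gt_max => /andP[/andP[eq aq] qs].
  exists q; split; first by move: sab => /andP[]; lra.
  by rewrite ltr_norml; apply/andP; split; lra.
have [qab sq] := qs.
have qab' : a <= ratr q <= b by move: qab => /andP[-> /ltW].
have := fe _ _ sab qab' sq; have := fq _ qab.
have := ler_norm (f s - f (ratr q)); lra.
Qed.

Section pitchfork.
Context {R : realType} {d : measure_display} {Omega : measurableType d}.
Variable P : probability Omega R.
Variables (eps sig T rho x0 : R) (mu : R -> R).
Variables (W x : R -> Omega -> R).
Hypothesis eps0 : 0 < eps.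
Local Notation s0 := (Num.sqrt eps).
Local Notation kappa := (sig / Num.sqrt eps).
Hypothesis bW : brownian_motion P W.
Hypothesis cmu : {within `[s0, T], continuous mu}.
Hypothesis solx : sde_solution eps sig T mu W x0 x.

Lemma measurable_euler (G : R -> R -> R) h k : 0 <= h ->
  (forall u, measurable_fun setT (G^~ u)) ->
  measurable_fun setT
    (fun w => euler G mu (fun s => kappa * W s w) x0 s0 h k).
Proof.
case: bW => mW _ _ _ _ h0 mG; elim: k => [|k IHk] /=.
  exact: measurable_cst.
have mWk j : measurable_fun setT (W (s0 + h * j%:R)).
  by apply: mW; rewrite addr_ge0 ?sqrtr_ge0// mulr_ge0.
apply: measurable_funD.
  apply: measurable_funD => //; apply: measurable_funM => //.
  exact: (measurableT_comp (mG _)).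
by apply: measurable_funB; apply: measurable_funM.
Qed.

(** Only the values of the drift along the path matter, so the same path solves the equation for any
    [G] that agrees with the original drift there. This serves both the original and the expanding
    drift. *)
Lemma sde_solution_drift (G : R -> R -> R) t w : t <= T ->
  (forall u, s0 <= u <= t ->
     G (x u w) (mu u) = eps^-1 * (mu u * x u w - x u w ^+ 3)) ->
  forall s, s0 <= s <= t ->
    x s w = x0 + \int[lebesgue_measure]_(u in `[s0, s]) G (x u w) (mu u) +
      (kappa * W s w - kappa * W s0 w).
Proof.
move=> tT GE s st; have [cx xE] := solx w.
rewrite xE; last by move: st; lra.
rewrite mulrBr; congr (_ + _ + _).
rewrite -RintegralZl//.
  apply: eq_Rintegral => u; rewrite inE/= in_itv/= => us.
  by rewrite GE//; move: st us; lra.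
apply: within_itv_integrable.
apply: (drift_continuous (G := fun y v => v * y - y ^+ 3) (x := x^~ w)).
- exact: locally_lipschitz_pitchfork.
- by apply: within_itvW cmu; move: st; lra.
- by apply: within_itvW cx; move: st; lra.
Qed.

Lemma measurable_solution s : s0 <= s <= T -> measurable_fun setT (x s).
Proof.
move=> /andP[s0s sT].
pose G y u : R := eps^-1 * (u * y - y ^+ 3).
have mG u : measurable_fun setT (G^~ u).
  apply: measurable_funM => //; apply: measurable_funB.
    exact: measurable_funM.
  exact: measurable_funX.
apply: (measurable_fun_cvg (h := fun n w => euler G mu (fun s => kappa * W s w)
  x0 s0 ((s - s0) / n%:R) n)).
  by move=> n; apply: measurable_euler => //; rewrite divr_ge0// subr_ge0.
move=> w _; apply: (euler_cvg (x := x^~ w)) => //.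
- exact: locally_lipschitzZ locally_lipschitz_pitchfork.
- by apply: within_itvW cmu.
- by have [cx _] := solx w; apply: within_itvW cx.
- exact: sde_solution_drift.
Qed.

(** A continuous function of time whose sign decides membership in the domain without a square
    root. *)
Definition excess w s := x s w ^+ 2 - (1 - rho) * mu s.

Hypothesis mu0 : forall s, s0 <= s <= T -> 0 <= (1 - rho) * mu s.

Lemma excess_continuous w t : t <= T -> {within `[s0, t], continuous (excess w)}.
Proof.
move=> tT; have [cx _] := solx w.
apply: (drift_continuous (G := fun y u => y ^+ 2 - (1 - rho) * u) (x := x^~ w)).
- exact: locally_lipschitz_parabola.
- exact: within_itvW cmu.
- exact: within_itvW cx.
Qed.

Lemma inD_excess w s : s0 <= s <= T ->
  inD eps T rho mu (x s w) s <-> excess w s <= 0.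
Proof.
move=> sT; rewrite /inD /excess subr_le0 -(real_normK (num_real (x s w))).
have sq : Num.sqrt ((1 - rho) * mu s) ^+ 2 = (1 - rho) * mu s.
  by rewrite sqr_sqrtr// mu0.
rewrite -[X in _ <-> _ <= X]sq ler_sqr ?nnegrE ?sqrtr_ge0//.
by split => [[]|].
Qed.

Lemma exit_eventE t : s0 < t <= T ->
  [set w | (t%:E <= exit_time eps T rho mu x w)%E] =
  [set w | forall s, s0 <= s <= t -> excess w s <= 0].
Proof.
move=> /andP[s0t tT]; apply/seteqP; split => w /= Ew.
  apply: le0_of_rational => //; first exact: excess_continuous.
  move=> q /andP[s0q qt]; apply/inD_excess; first by lra.
  apply: contrapT => nD.
  have : (exit_time eps T rho mu x w <= (ratr q)%:E)%E.
    by apply: ereal_inf_lbound; exists (ratr q).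
  by move=> /(le_trans Ew); rewrite lee_fin leNgt qt.
apply: le_ereal_inf_tmp => _ [s [s0s nD] <-]; rewrite lee_fin leNgt.
apply/negP => st; apply: nD; apply/inD_excess; first by lra.
by apply: Ew; lra.
Qed.

Lemma measurable_exit_event t : s0 < t <= T ->
  measurable [set w | (t%:E <= exit_time eps T rho mu x w)%E].
Proof.
move=> /[dup] stT /andP[s0t tT]; rewrite exit_eventE//.
have mx s : s0 <= s <= T -> measurable [set w | excess w s <= 0].
  move=> sT.
  have mf : measurable_fun setT (excess^~ s).
    apply: measurable_funB => //; apply: measurable_funX.
    exact: measurable_solution.
  rewrite (_ : [set w | _] = (excess^~ s) @^-1` `]-oo, 0]).
    by rewrite -[X in measurable X]setTI; exact: mf.
  by apply/seteqP; split => w; rewrite /= in_itv.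
(* The rationals are enumerated by [unpickle]; an index that codes no rational, or one outside the
   time range, contributes [setT]. *)
pose F (n : nat) : set Omega := if @unpickle rat n is Some q then
  if s0 <= ratr q < t then [set w | excess w (ratr q) <= 0] else setT else setT.
rewrite (_ : [set w | _] = \bigcap_n F n).
  apply: bigcapT_measurable => n; rewrite /F; case: unpickle => // q.
  by case: ifPn => // qt; apply: mx; lra.
apply/seteqP; split => w /= Ew.
  move=> n _; rewrite /F; case: unpickle => // q.
  by case: ifPn => //= qt; apply: Ew; lra.
apply: le0_of_rational => //; first exact: excess_continuous.
by move=> q qt; have := Ew (pickle q) I; rewrite /F pickleK qt.
Qed.

Lemma euler_increment_independent (n : nat) (h : R) : 0 < h ->
  forall A : nat -> set R, (forall i, measurable (A i)) ->
  P [set w | forall i, (i < n)%N ->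
       A i (W (s0 + h * i.+1%:R) w - W (s0 + h * i%:R) w)] =
  (\prod_(i < n) P [set w | A i (W (s0 + h * i.+1%:R) w - W (s0 + h * i%:R) w)%R])%E.
Proof.
move=> h0 A mA; case: bW => _ _ _ _ /(_ n (fun i => s0 + h * i%:R) A) -> //.
  by rewrite /= mulr0 addr0 sqrtr_ge0.
by move=> i _; rewrite ltrD2l ltr_pM2l// ltr_nat.
Qed.

End pitchfork.

(** * Escape from D(rho) *)

(** Lowering the exponent from [q] to [q / (1 + eta)] costs a factor at least [1 - q * eta], and the
    hypothesis limits the loss [expR q * (q * eta)] to half of [expR q - 1]. *)
Lemma expR_rescale (R : realType) (q eta : R) : 0 < q -> 0 <= eta ->
  2 * (q * eta) <= 1 - expR (- q) ->
  (expR q - 1) / 2 <= expR (q / (1 + eta)) - 1.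
Proof.
move=> q0 eta0 qeta.
have E0 := expR_gt0 q.
have z : 1 - q * eta <= expR (- (q * eta / (1 + eta))).
  apply: le_trans (expR_ge1Dx _); rewrite lerD2l lerN2 ler_pdivrMr; last by lra.
  by rewrite ler_peMr ?mulr_ge0 ?(ltW q0)//; lra.
have -> : q / (1 + eta) = q + - (q * eta / (1 + eta)).
  by field; rewrite gt_eqF//; lra.
have EE : expR q * expR (- q) = 1 by rewrite -expRD subrr expR0.
rewrite expRD; have := ler_wpM2l (ltW E0) z.
have := ler_wpM2l (ltW E0) qeta.
by move: EE; move: (expR q) (expR (- q)) (expR (- _)) => a b c; nra.
Qed.

(** Dropping the first summand of the denominator and comparing squares leaves
    [24 * rho * (1 - rho) <= 25], whence the constant 5. *)
Lemma escape_rate_bound (R : realType) (rho m sig q V : R) :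
  0 < rho < 1 -> 0 < m -> 0 < sig -> 0 < q ->
  sig ^+ 2 / (3 * rho * m) * ((expR q - 1) / 2) <= V ->
  Num.sqrt (4 * ((1 - rho) * m) / (4 * ((1 - rho) * m) + V)) <=
  5 * (m / sig) * (expR (- (q / 2)) / Num.sqrt (1 - expR (- q))).
Proof.
move=> /andP[rho0 rho1] m0 sig0 q0 VE.
have E1 : 1 < expR q by rewrite -expR0 ltr_expR.
have N1 : expR (- q) < 1 by rewrite -[ltRHS]expR0 ltr_expR oppr_lt0.
set Y := 5 * _ * _.
have Y0 : 0 <= Y by rewrite !mulr_ge0 ?invr_ge0 ?expR_ge0 ?sqrtr_ge0 ?(ltW m0) ?(ltW sig0).
rewrite -[Y]ger0_norm// -sqrtr_sqr; apply: ler_wsqrtr.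
have -> : Y ^+ 2 = 25 * (m / sig) ^+ 2 / (expR q - 1).
  rewrite /Y !exprMn !exprVn sqr_sqrtr; last by rewrite subr_ge0 ltW.
  have -> : expR (- (q / 2)) ^+ 2 = expR (- q).
    by rewrite -expRM_natl; congr expR; field.
  rewrite expRN; field.
  by rewrite !gt_eqF ?expR_gt0 ?subr_gt0.
set b := 4 * _.
have b0 : 0 < b by rewrite /b !mulr_gt0// subr_gt0.
have D0 : 0 < 3 * rho * m by rewrite !mulr_gt0.
have s2 : 0 < sig ^+ 2 by rewrite exprn_gt0.
have L0 : 0 < sig ^+ 2 / (3 * rho * m) * ((expR q - 1) / 2).
  by rewrite !mulr_gt0 ?invr_gt0 ?subr_gt0 ?mulr_gt0.
apply: (@le_trans _ _ (b / (sig ^+ 2 / (3 * rho * m) * ((expR q - 1) / 2)))).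
  rewrite ler_wpM2l ?(ltW b0)// lef_pV2 ?posrE//; last by rewrite addr_gt0// (lt_le_trans L0).
  by rewrite ler_wpDl// ltW.
have -> : b / (sig ^+ 2 / (3 * rho * m) * ((expR q - 1) / 2)) =
    (24 * (rho * (1 - rho))) * (m / sig) ^+ 2 / (expR q - 1).
  rewrite /b; field.
  by rewrite !gt_eqF// subr_gt0.
rewrite ler_wpM2r ?invr_ge0 ?subr_ge0 ?(ltW E1)// ler_wpM2r ?sqr_ge0//.
by nra.
Qed.

Section escape.
Context {R : realType} {d : measure_display} {Omega : measurableType d}.
Variable P : probability Omega R.
Variables (eps sig T rho x0 t : R) (mu : R -> R).
Variables (W x : R -> Omega -> R).
Hypothesis eps0 : 0 < eps.
Hypothesis sig0 : 0 < sig.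
Hypothesis rho01 : 0 < rho < 1.
Local Notation s0 := (Num.sqrt eps).
Local Notation kappa := (sig / Num.sqrt eps).
Local Notation al := (alpha mu t s0).
Hypothesis bW : brownian_motion P W.
Hypothesis cmu : {within `[s0, T], continuous mu}.
Hypothesis solx : sde_solution eps sig T mu W x0 x.
Hypothesis stT : s0 < t <= T.
Hypothesis mu_gt0 : forall s, s0 <= s <= T -> 0 < mu s.
Hypothesis mu_le : forall u v, s0 <= u -> u <= v -> v <= T -> mu u <= mu v.

Let s0t : s0 < t. Proof. by case/andP: stT. Qed.
Let tT : t <= T. Proof. by case/andP: stT. Qed.
Let rho0 : 0 < rho. Proof. by case/andP: rho01. Qed.
Let rho1 : rho < 1. Proof. by case/andP: rho01. Qed.
Let mut_gt0 : 0 < mu t. Proof. by apply: mu_gt0; rewrite ltW. Qed.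

Lemma alpha_gt0 : 0 < al.
Proof.
have m0 : 0 < mu s0 by apply: mu_gt0; rewrite lexx/= (le_trans (ltW s0t)).
apply: (@lt_le_trans _ _ (mu s0 * (t - s0))).
  by rewrite mulr_gt0// subr_gt0.
rewrite -(Rintegral_cst_itv _ (ltW s0t)); apply: le_Rintegral => //.
- by apply: within_itv_integrable; apply/continuous_subspaceT => ?; exact: cvg_cst.
- by apply: within_itv_integrable; exact: within_itvW cmu.
- move=> u; rewrite /= in_itv/= => /andP[su ut].
  by apply: mu_le => //; exact: le_trans tT.
Qed.

Let G (y u : R) := eps^-1 * expanding_drift rho y u.

Let lipG : locally_lipschitz G.
Proof.
apply: locally_lipschitzZ; apply: locally_lipschitz_expanding_drift.
by rewrite !ltW.
Qed.

Let mG u : measurable_fun setT (G^~ u).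
Proof.
apply: measurable_funM => //; apply: measurable_funM => //.
by apply: measurable_maxr => //; exact: measurable_funB.
Qed.

Let X n w := euler G mu (fun s => kappa * W s w) x0 s0 ((t - s0) / n%:R) n.

Let rate n k := rho / eps * ((t - s0) / n%:R * mu (s0 + (t - s0) / n%:R * k.+1%:R)).

Let V n :=
  scheme_var (fun k => 1 + rate n k) (kappa ^+ 2 * ((t - s0) / n%:R)) n.

Let grid n k : (0 < n)%N -> (k <= n)%N ->
  s0 <= s0 + (t - s0) / n%:R * k%:R <= t.
Proof.
move=> n0 kn; have ts : 0 <= t - s0 by rewrite subr_ge0 ltW.
rewrite lerDl mulr_ge0 ?divr_ge0//= -lerBrDl -mulrA ler_piMr//.
by rewrite mulrC ler_pdivrMr ?ltr0n// mul1r ler_nat.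
Qed.

Lemma euler_small_ball n (b : R) : (0 < n)%N -> 0 < b ->
  (P [set w | (`|X n w| <= b)%R] <=
   (expR (1 / 2) * Num.sqrt (b ^+ 2 / (b ^+ 2 + V n)))%:E)%E.
Proof.
move=> n0 b0; set h := (t - s0) / n%:R.
have h0 : 0 < h by rewrite divr_gt0 ?ltr0n// subr_gt0.
pose xif k w := W (s0 + h * k.+1%:R) w - W (s0 + h * k%:R) w.
have mxi k : measurable_fun setT (xif k).
  have [mW _ _ _ _] := bW.
  by apply: measurable_funB; apply: mW; rewrite addr_ge0 ?sqrtr_ge0// mulr_ge0// ltW.
pose Xf k w := euler G mu (fun s => kappa * W s w) x0 s0 h k.
have mX k : measurable_fun setT (Xf k).
  by apply: (measurable_euler eps sig x0 mu bW) => //; exact: ltW.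
pose xi k : {mfun Omega >-> R} :=
  HB.pack (xif k) (isMeasurableFun.Build _ _ _ _ _ (mxi k)).
pose X' k : {mfun Omega >-> R} :=
  HB.pack (Xf k) (isMeasurableFun.Build _ _ _ _ _ (mX k)).
pose g k y := y + h * G y (mu (s0 + h * k.+1%:R)).
have mu_grid k : (k < n)%N -> 0 < mu (s0 + h * k.+1%:R).
  move=> kn; apply: mu_gt0; have /andP[-> /le_trans] := grid n0 kn; exact.
have rate0 k : (k < n)%N -> 0 < rate n k.
  move=> kn.
  exact: mulr_gt0 (divr_gt0 rho0 eps0) (mulr_gt0 h0 (mu_grid k kn)).
apply: (gaussian_scheme_small_ball (xi := xi) (X := X') (g := g) (x0 := x0)) => //.
- move=> k; apply: measurable_funD => //; apply: measurable_funM => //; exact: mG.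
- by move=> k w; rewrite /= /Xf /= /xif /g; ring.
- by move=> k kn; rewrite addr_gt0// rate0.
(* One step multiplies [y] by [1 + h / eps * M], and the maximum [M] is at least [rho * u]. *)
- move=> k y kn; rewrite /g /G /expanding_drift.
  set u := mu _; set M := Num.max _ _.
  have Mu : rho * u <= M by rewrite /M le_max lexx orbT.
  have -> : y + h * (eps^-1 * (y * M)) = (1 + h / eps * M) * y by ring.
  have rE : rate n k = h / eps * (rho * u) by rewrite /rate -/h -/u; ring.
  have he : 0 <= h / eps by rewrite divr_ge0 ?ltW.
  have rM : rate n k <= h / eps * M by rewrite rE ler_wpM2l.
  have rk := rate0 k kn.
  by rewrite normrM ler_wpM2r// (le_trans _ (ler_norm _))// lerD2l.
- move=> k A kn mA; have [_ _ _ + _] := bW.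
  have tk : 0 <= s0 + h * k%:R.
    by apply: addr_ge0; [exact: sqrtr_ge0|exact: mulr_ge0 (ltW h0) _].
  have tk1 : s0 + h * k%:R < s0 + h * k.+1%:R by rewrite ltrD2l ltr_pM2l// ltr_nat.
  move=> /(_ _ _ _ tk tk1 mA); rewrite (_ : s0 + h * k.+1%:R - _ = h); first exact.
  by rewrite -natr1; ring.
- exact: euler_increment_independent.
Qed.

(** Each rate [r] is at most [s = rho / eps * (h * mu t)], because [mu] is increasing, and [s <= 1].
    Hence [(1 + r) ^+ 2 - 1 <= 3 * s], which explains the 3: the noise variance per step is exactly
    [3 * s] times the prefactor. The rates sum to at least [rho * al / eps], as right-end sums. *)
Lemma scheme_var_escape_ge n (eta : R) : (0 < n)%N -> 0 <= eta <= 1 ->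
  rho / eps * ((t - s0) / n%:R * mu t) <= eta ->
  sig ^+ 2 / (3 * rho * mu t) *
    (expR (2 * rho * al / eps / (1 + eta)) - 1) <= V n.
Proof.
move=> n0 /andP[eta0 eta1] rate_eta.
set h := (t - s0) / n%:R in rate_eta *.
have h0 : 0 < h by rewrite divr_gt0 ?ltr0n// subr_gt0.
have hn : s0 + h * n%:R = t.
  by rewrite /h divfK ?subrKC// pnatr_eq0 -lt0n.
have l0 : 0 <= sig ^+ 2 / (3 * rho * mu t).
  by rewrite divr_ge0 ?sqr_ge0// !mulr_ge0// ltW.
have re : 0 < rho / eps by rewrite divr_gt0.
have rate_le k : (k < n)%N -> 0 <= rate n k <= rho / eps * (h * mu t).
  move=> kn; have /andP[sk kt] := grid n0 kn.
  have mk : 0 < mu (s0 + h * k.+1%:R) by apply: mu_gt0; rewrite sk (le_trans kt).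
  rewrite /rate -/h ler_pM2l// ler_pM2l// mu_le// andbT.
  exact: mulr_ge0 (ltW re) (mulr_ge0 (ltW h0) (ltW mk)).
have := @scheme_var_lower_bound R (rate n) (kappa ^+ 2 * h)
  (sig ^+ 2 / (3 * rho * mu t)) eta n l0.
move=> /(_ _ eta0 _ n (leqnn n)) VB; apply: le_trans (VB _ _); last 2 first.
- by rewrite mulr_ge0 ?sqr_ge0// ltW.
- move=> k kn; have /andP[r0 rle] := rate_le k kn.
  rewrite r0 (le_trans rle)//; split=> //.
  have -> : kappa ^+ 2 * h =
      sig ^+ 2 / (3 * rho * mu t) * (3 * (rho / eps * (h * mu t))).
    rewrite exprMn exprVn sqr_sqrtr ?(ltW eps0)//; field.
    by rewrite !gt_eqF.
  rewrite ler_wpM2l//; have re1 := le_trans rate_eta eta1.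
  by move: r0 rle re1; move: (rate n k) (rho / eps * _) => r s; nra.
rewrite ler_wpM2l// lerD2r ler_expR.
have -> : 2 * rho * al / eps / (1 + eta) = 2 / (1 + eta) * (rho / eps * al).
  by field; rewrite !gt_eqF//; lra.
rewrite ler_wpM2l ?divr_ge0//; first lra.
rewrite /rate -/h -mulr_sumr ler_pM2l// /alpha -{1}hn.
apply: right_sum_ge_integral; rewrite ?hn; first exact: ltW.
  exact: within_itvW cmu.
by move=> u v su uv vt; apply: mu_le => //; exact: le_trans tT.
Qed.

(** While [x] stays in the domain, the maximum in [expanding_drift] is attained by its first
    argument, so the path solves the modified equation. *)
Lemma euler_cvg_solution w : (forall s, s0 <= s <= t -> excess rho mu x w s <= 0) ->
  X n w @[n --> \oo] --> x t w.
Proof.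
move=> Ew; apply: (euler_cvg (x := x^~ w)) => //.
- exact: ltW.
- exact: within_itvW cmu.
- by have [cx _] := solx w; exact: within_itvW cx.
- apply: (sde_solution_drift cmu solx tT) => u /Ew Eu.
  rewrite /G /expanding_drift max_l; first by congr (_ * _); ring.
  by move: Eu; rewrite /excess; lra.
Qed.

Lemma escape_probability_le :
  (P [set w | (t%:E <= exit_time eps T rho mu x w)%E] <=
   (5 * expR (1 / 2) * (mu t / sig) *
     (expR (- (rho * al / eps)) /
      Num.sqrt (1 - expR (- (2 * rho * al / eps)))))%:E)%E.
Proof.
have mu0 s : s0 <= s <= T -> 0 <= (1 - rho) * mu s.
  by move=> /mu_gt0 ms; rewrite mulr_ge0 ?subr_ge0 ?ltW.
pose q := 2 * rho * al / eps.
have q0 : 0 < q by rewrite !mulr_gt0 ?invr_gt0// alpha_gt0.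
(* Twice the radius of the domain at time [t]: the limit then lies strictly inside the ball, so the
   approximations eventually enter it. *)
pose b := 2 * Num.sqrt ((1 - rho) * mu t).
have b0 : 0 < b by rewrite mulr_gt0// sqrtr_gt0 mulr_gt0// subr_gt0.
have b2 : b ^+ 2 = 4 * ((1 - rho) * mu t).
  rewrite exprMn sqr_sqrtr; first by ring.
  by rewrite mulr_ge0 ?subr_ge0 ?(ltW rho1) ?(ltW mut_gt0).
apply: (measure_le_liminf (A := fun n => [set w | `|X n w| <= b])).
- exact (measurable_exit_event bW cmu solx mu0 stT).
- move=> n; have mXn : measurable_fun setT (X n).
    by apply: (measurable_euler eps sig x0 mu bW) => //; rewrite divr_ge0// subr_ge0 ltW.
  rewrite (_ : [set w | _] = X n @^-1` `[- b, b]).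
    by rewrite -[A in measurable A]setTI; exact: mXn.
  by apply/seteqP; split => w; rewrite /= in_itv/= ler_norml.
- rewrite (exit_eventE cmu solx mu0 stT) => w /= Ew.
  have xb : `|x t w| < b.
    have := Ew t; rewrite lexx ltW// /excess subr_le0 => /(_ isT) xt.
    rewrite -ltr_sqr ?nnegrE ?(ltW b0)// real_normK ?num_real// b2.
    apply: le_lt_trans xt _; rewrite ltr_pMl ?ltr1n//.
    by rewrite mulr_gt0// subr_gt0.
  have bx : 0 < b - `|x t w| by rewrite subr_gt0.
  have /cvgrPdist_lt /(_ _ bx) := euler_cvg_solution Ew.
  apply: filterS => n Xn /=.
  have := ler_normD (X n w - x t w) (x t w); rewrite subrK distrC.
  by move: Xn; lra.
(* The first bound serves [scheme_var_escape_ge], the second is the condition of [expR_rescale];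
   [eta] does not depend on [n], so a fine enough grid brings all rates below it. *)
pose eta := Num.min 1 ((1 - expR (- q)) / (2 * q)).
have N1 : expR (- q) < 1 by rewrite -[ltRHS]expR0 ltr_expR oppr_lt0.
have eta0 : 0 < eta.
  rewrite lt_min ltr01/=; apply: divr_gt0; first by rewrite subr_gt0.
  exact: mulr_gt0.
have etaq : 2 * (q * eta) <= 1 - expR (- q).
  have q2 : 0 < 2 * q by exact: mulr_gt0.
  by rewrite mulrA mulrC -ler_pdivlMr// ge_min lexx orbT.
have eta1 : eta <= 1 by rewrite ge_min lexx.
pose N := (Num.trunc (rho / eps * ((t - s0) * mu t) / eta)).+1.
exists N => // n /= Nn.
have n0 : (0 < n)%N by exact: leq_trans Nn.
have n0R : 0 < n%:R :> R by rewrite ltr0n.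
have rate_eta : rho / eps * ((t - s0) / n%:R * mu t) <= eta.
  rewrite (_ : _ * _ = rho / eps * ((t - s0) * mu t) / n%:R); last by ring.
  rewrite ler_pdivrMr// [leRHS]mulrC -ler_pdivrMr//; apply: ltW.
  apply: (@lt_le_trans _ _ N%:R); first by rewrite /N truncnS_gt// num_real.
  by rewrite ler_nat.
apply: le_trans (euler_small_ball n0 b0) _.
have qE : rho * al / eps = q / 2 by rewrite /q; field; rewrite gt_eqF.
rewrite lee_fin b2 qE -/q (_ : 5 * _ * _ * _ = expR (1 / 2) * (5 * (mu t / sig) *
  (expR (- (q / 2)) / Num.sqrt (1 - expR (- q))))); last by ring.
rewrite ler_pM2l ?expR_gt0//; apply: escape_rate_bound => //.
apply: le_trans (scheme_var_escape_ge n0 _ rate_eta); last by rewrite ltW.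
rewrite ler_wpM2l ?divr_ge0 ?sqr_ge0 ?mulr_ge0 ?(ltW rho0) ?(ltW mut_gt0)//.
exact: expR_rescale (ltW eta0) etaq.
Qed.

End escape.

(** * Choice of the constants and conclusion *)

Unset Implicit Arguments.
Set Strict Implicit.
Set Printing Implicit Defensive.

Theorem theorem5p1 (R : realType) (t0 T : R) (mu : R -> R) :
  t0 < 0 -> 0 < T ->
  {within `[t0, T], continuous mu} ->
  (forall s u, t0 <= s -> s < u -> u <= T -> mu s < mu u) ->
  (exists M : R, forall t, t0 <= t <= T -> `|mu t - t| <= M * t ^+ 2) ->
  forall K : R, 0 < K ->
  forall rho : R, 0 < rho < 2 / 3 ->
  exists c : R, 0 < c /\
  exists eps0 : R, 0 < eps0 /\
  forall eps sig : R, 0 < eps < eps0 -> 0 < sig < eps0 ->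
    sig * (`|ln sig| `^ (3 / 2)) <= K * Num.sqrt eps ->
  forall (d : measure_display) (Omega : measurableType d)
         (P : probability Omega R) (W : R -> Omega -> R)
         (x0 : R) (x : R -> Omega -> R),
    brownian_motion P W ->
    sde_solution eps sig T mu W x0 x ->
    inD eps T rho mu x0 (Num.sqrt eps) ->
  forall t : R, Num.sqrt eps < t <= T ->
    (P [set w | (t%:E <= exit_time eps T rho mu x w)%E] <=
     (c * mu t * (1 + alpha mu t (Num.sqrt eps) / eps)
      * (`|ln sig| / sig)
      * (expR (- (rho * alpha mu t (Num.sqrt eps) / eps))
         / Num.sqrt (1 - expR (- (2 * rho * alpha mu t (Num.sqrt eps) / eps)))))%:E)%E.
Proof.
move=> t00 T0 cmu mu_lt [M muM] K K0 rho /andP[rho0 rho23].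
(* The constant of [escape_probability_le]. For [sig] below [expR (- 1)] the factor [|ln sig|] is at
   least 1, as is [1 + alpha / eps], so inserting both only enlarges the bound. *)
exists (5 * expR (1 / 2)); split; first by rewrite mulr_gt0 ?expR_gt0.
exists (expR (- 1)); split; first exact: expR_gt0.
move=> eps sig /andP[eps0 _] /andP[sig0 sig1] _ d Omega P W x0 x bW solx _ t stT.
have s0 : 0 < Num.sqrt eps by rewrite sqrtr_gt0.
(* The quadratic remainder vanishes at time 0; strict monotonicity then makes [mu] positive at later
   times. *)
have mu00 : mu 0 = 0.
  have := muM 0; rewrite expr0n/= mulr0 subr0 normr_le0 => mu0.
  by apply/eqP; apply: mu0; rewrite !ltW.
have mu_gt0 s : Num.sqrt eps <= s <= T -> 0 < mu s.
  move=> /andP[ss sT]; rewrite -mu00; apply: mu_lt => //; first exact: ltW.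
  exact: lt_le_trans ss.
have mu_le u v : Num.sqrt eps <= u -> u <= v -> v <= T -> mu u <= mu v.
  move=> su; rewrite le_eqVlt => /predU1P[->//|uv] vT.
  by apply/ltW/mu_lt => //; move: s0 su t00; lra.
have cmu' : {within `[Num.sqrt eps, T], continuous mu}.
  by apply: within_itvW cmu => //; move: s0 t00; lra.
have rho01 : 0 < rho < 1 by rewrite rho0/=; lra.
apply: le_trans (escape_probability_le eps0 sig0 rho01 bW cmu' solx stT mu_gt0 mu_le) _.
have al0 := alpha_gt0 cmu' stT mu_gt0 mu_le.
have mut : 0 < mu t by apply: mu_gt0; case/andP: stT => /ltW -> ->.
have lnsig : 1 <= `|ln sig|.
  have : ln sig < -1 by rewrite -[X in _ < X]expRK ltr_ln ?posrE ?expR_gt0.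
  by move=> ls; rewrite ltr0_norm; lra.
rewrite lee_fin ler_wpM2r ?divr_ge0 ?expR_ge0 ?sqrtr_ge0//.
have ae : 1 <= 1 + alpha mu t (Num.sqrt eps) / eps.
  by rewrite lerDl divr_ge0 ?ltW.
have := expR_gt0 (1 / 2 : R); move: (expR (1 / 2)) => e e0.
rewrite -!mulrA !ler_pM2l// mulrA ler_peMl//.
  by rewrite invr_ge0 ltW.
by rewrite mulr_ege1.
Qed.
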